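(* Let $\kappa\in\mathcal{L}$ with $f(|m(\kappa)|)<B$, let $\hat\kappa(n)$ be the empirical distribution of $n$ i.i.d. samples from $\kappa$, and let $u\ge0$. Then \[ \mathbb{P}\big(\mathrm{KL}_{\inf}(\hat\kappa(n),m(\kappa))\ge u\big)\le (n+1)^2e^{\tilde B_1}e^{-nu}, \] where $\tilde B_1=d_1+d_2$ with $d_1=\frac{\mathbb{E}_\kappa|X-m(\kappa)|}{2(f^{-1}(B)-m(\kappa))}$ and $d_2=\frac{\mathbb{E}_\kappa|B-f(|X|)|}{2(B-f(|m(\kappa)|))}$.
   Context: $\mathcal{P}(\mathbb{R})$: probability distributions on $\mathbb{R}$ with finite mean; $m(\eta)$: mean. Fix a strictly increasing, continuous, non-negative, convex $f:[0,\infty)\to[0,\infty)$ with $f(y)/y\to\infty$, and $B>0$; $\mathcal{L}=\{\eta\in\mathcal{P}(\mathbb{R}):\mathbb{E}_\eta f(|X|)\le B\}$. $\mathrm{KL}(\eta,\kappa)=\int\log\frac{d\eta}{d\kappa}d\eta$ ($+\infty$ if $\eta\not\ll\kappa$). For $\eta\in\mathcal{P}(\mathbb{R})$ and $f(|x|)<B$: $\mathrm{KL}_{\inf}(\eta,x)=\inf\{\mathrm{KL}(\eta,\kappa'):\kappa'\in\mathcal{L},m(\kappa')\ge x\}$ if $x\ge m(\eta)$, and $=\inf\{\mathrm{KL}(\eta,\kappa'):\kappa'\in\mathcal{L},m(\kappa')\le x\}$ if $x<m(\eta)$. *)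

(* Defs.v *)
From HB Require Import structures.
From mathcomp Require Import all_boot all_order all_algebra.
From mathcomp Require Import all_classical all_reals all_analysis.
Set Implicit Arguments. Unset Strict Implicit. Unset Printing Implicit Defensive.
Import Order.TTheory GRing.Theory Num.Theory.
Import numFieldNormedType.Exports.
Local Open Scope classical_set_scope.
Local Open Scope ring_scope.

Section Defs.
Variable R : realType.

Definition mean (eta : {measure set R -> \bar R}) : R := fine (\int[eta]_x (x%:E))%E.

(* KL(eta, kappa) = \int log (d eta / d kappa) d eta, and +oo if eta is not
   absolutely continuous w.r.t. kappa.  A density g of eta w.r.t. kappa is
   unique kappa-a.e. (hence eta-a.e.), so the infimum below is over a set of
   equal values when eta << kappa, and is the infimum of the empty set, +oo,
   otherwise. *)
Definition is_density (eta kappa : {measure set R -> \bar R}) (g : R -> R) : Prop :=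
  measurable_fun setT g /\ (forall x, 0 <= g x) /\
  (forall A, measurable A -> (eta A = \int[kappa]_(x in A) (g x)%:E)%E).

Definition KL (eta kappa : {measure set R -> \bar R}) : \bar R :=
  ereal_inf [set (\int[eta]_x (ln (g x))%:E)%E | g in is_density eta kappa].

Definition finite_mean (eta : probability R R) : Prop :=
  eta.-integrable setT (fun x => x%:E).

Definition inL (f : R -> R) (B : R) (eta : probability R R) : Prop :=
  finite_mean eta /\ (\int[eta]_x (f `|x|)%:E <= B%:E)%E.

Definition KLinf (f : R -> R) (B : R) (eta : {measure set R -> \bar R}) (x : R) : \bar R :=
  if mean eta <= x then
    ereal_inf [set KL eta k | k in [set k : probability R R | inL f B k /\ x <= mean k]]
  else
    ereal_inf [set KL eta k | k in [set k : probability R R | inL f B k /\ mean k <= x]].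

Definition empirical (n : nat) (xs : nat -> R) : {measure set R -> \bar R} :=
  mscale ((n%:R)^-1)%:nng (msum (fun k => \d_(xs k)) n).

Definition mutually_independent d (T : measurableType d) (P : probability T R)
  (n : nat) (X : nat -> {RV P >-> R}) : Prop :=
  forall A : 'I_n -> set R, (forall i, measurable (A i)) ->
    P (\big[setI/setT]_(i < n) (X i @^-1` A i)) =
    (\prod_(i < n) P (X i @^-1` A i))%E.

Definition convex_on_nonneg (f : R -> R) : Prop :=
  forall x y t, 0 <= x -> 0 <= y -> 0 <= t <= 1 ->
    f (t * x + (1 - t) * y) <= t * f x + (1 - t) * f y.

End Defs.

(* Main.v *)
Require Import Defs.
From HB Require Import structures.
From mathcomp Require Import all_boot all_order all_algebra.
From mathcomp Require Import all_classical all_reals all_analysis.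
From mathcomp Require Import measurable_realfun.
From mathcomp Require Import zify ring lra.
Import Order.TTheory GRing.Theory Num.Theory.
Import numFieldNormedType.Exports.
Local Open Scope classical_set_scope.
Local Open Scope ring_scope.

(** Write [b y = B - f |y|], [m = m(kappa)] and
    [Z_l y = 1 - l.1 (y - m) - l.2 (b y)], and let [Lambda] be the convex set of
    the [l] with [0 <= l.2] and [Z_l >= 0] on the whole line.

    Lagrangian duality, with the constraints "mass at most 1", "mean on the right
    side of [m]" and "f-moment at most B" on finitely supported measures, turns
    [u <= KLinf(empirical, m)] into the existence of [l] in [Lambda] with
    [e^(nu) <= \prod_i Z_l(X_i)].  Both cases of [KLinf] are covered by the one
    set [Lambda], the sign of [l.1] being free.

    For each fixed [l] in [Lambda] the product has expectation at most 1.  The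
    supremum over [l] costs a factor [n+1] per dimension: moving a fraction [a]
    of the way from the maximizer towards another point of [Lambda] multiplies
    the product by at least [(1 - a)^n], and the average of [(1 - a)^n] over
    [[0, 1]] is [1 / (n + 1)].  Averaging over a grid of mesh [1/N] in [Lambda],
    applying Markov's inequality and letting [N] tend to infinity gives
    [(n+1)^2 e^(-nu)]; the factor [e^(B1)] is at least 1. *)

(** * Lagrange multipliers for one scalar constraint *)

Section Lagrange.
Context {R : realType}.

Lemma exists_between (A C : set R) : A !=set0 -> C !=set0 ->
  (forall a c, A a -> C c -> a <= c) ->
  exists l, (forall a, A a -> a <= l) /\ (forall c, C c -> l <= c).
Proof.
move=> A0 [c Cc] AC; exists (sup A); split.
  move=> a Aa; apply: ub_le_sup => //; exists c => x Ax; exact: AC.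
by move=> c' Cc'; apply: ge_sup => // a Aa; exact: AC.
Qed.

(** Points with [G < 0] bound [l] from below, points with [G > 0] bound it from above, and concavity
    makes these bounds compatible. Concavity is phrased as existence of a dominating [z], so [T]
    needs no linear structure. *)
Lemma lagrange_multiplier (T : Type) (D : set T) (F G : T -> R) (v : R) :
  (forall x y t, D x -> D y -> 0 <= t <= 1 -> exists z, [/\ D z,
    t * F x + (1 - t) * F y <= F z & t * G x + (1 - t) * G y <= G z]) ->
  (exists x, D x /\ 0 < G x) ->
  (forall x, D x -> 0 <= G x -> F x <= v) ->
  exists2 l, 0 <= l & forall x, D x -> F x + l * G x <= v.
Proof.
move=> DFG [x0 [Dx0 Gx0]] Fv.
(* The element 0 of [A] forces [0 <= l] and keeps [A] nonempty; the point with [0 < G x] keeps [C]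
   nonempty. *)
pose A := [set a | a = 0 \/ exists x, [/\ D x, G x < 0 & a = (F x - v) / (- G x)]].
pose C := [set c | exists x, [/\ D x, 0 < G x & c = (v - F x) / G x]].
have [l [Al Cl]] : exists l, (forall a, A a -> a <= l) /\ (forall c, C c -> l <= c).
  apply: exists_between.
  - by exists 0; left.
  - by exists ((v - F x0) / G x0), x0.
  - move=> _ _ [->|[x [Dx Gx ->]]] [y [Dy Gy ->]].
      by rewrite divr_ge0 ?(ltW Gy)// subr_ge0 Fv// ltW.
    (* At this weight the mixture of [G x] and [G y] is exactly 0, so the dominating point is
       feasible. *)
    pose t := G y / (G y - G x).
    have d0 : 0 < G y - G x by lra.
    have t01 : 0 <= t <= 1.
      by rewrite /t divr_ge0 ?(ltW Gy) ?(ltW d0)//= ler_pdivrMr//; lra.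
    have [z [Dz Fz Gz]] := DFG x y t Dx Dy t01.
    have tE : t * G x + (1 - t) * G y = 0.
      by rewrite /t; field; rewrite gt_eqF.
    have := Fv z Dz; rewrite -tE => /(_ Gz) Fzv.
    have : t * F x + (1 - t) * F y <= v by lra.
    have -> : t * F x + (1 - t) * F y = (G y * F x - G x * F y) / (G y - G x).
      by rewrite /t; field; rewrite gt_eqF.
    rewrite ler_pdivrMr// => H.
    rewrite ler_pdivrMr ?oppr_gt0// mulrAC ler_pdivlMr//.
    nra.
exists l => [|x Dx]; first by apply: Al; left.
have [Gx|Gx|Gx] := ltgtP (G x) 0.
- have := Al _ (or_intror (ex_intro _ x (And3 Dx Gx erefl))).
  by rewrite ler_pdivrMr ?oppr_gt0//; lra.
- have := Cl _ (ex_intro _ x (And3 Dx Gx erefl)).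
  by rewrite ler_pdivlMr//; lra.
- by rewrite Gx mulr0 addr0 Fv// Gx.
Qed.

End Lagrange.

(** * Power sums compared with the integral of a power *)

Section PowerSum.
Context {R : realFieldType}.

Lemma exprS_sub_le (n : nat) (a b : R) : 0 <= b <= a ->
  a ^+ n.+1 - b ^+ n.+1 <= n.+1%:R * (a - b) * a ^+ n.
Proof.
move=> /andP[b0 ba]; have a0 : 0 <= a by lra.
rewrite subrXX mulrAC mulrC ler_wpM2r ?subr_ge0//.
rewrite mulr_natl -[X in _ <= _ *+ X]card_ord -sumr_const.
apply: ler_sum => i _; rewrite -[X in _ <= a ^+ X](@subnK i n) ?leq_ord//.
by rewrite exprD ?subSS ler_wpM2l ?exprn_ge0// lerXn2r// nnegrE.
Qed.

(** An upper Riemann sum for the integral of [x ^ n] over [[0, j]], with [exprS_sub_le] bounding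
    each cell. *)
Lemma le_sum_pow (n j : nat) :
  (j%:R : R) ^+ n.+1 <= n.+1%:R * \sum_(k < j.+1) k%:R ^+ n.
Proof.
elim: j => [|j IH].
  by rewrite expr0n/= mulr_ge0// sumr_ge0// => i _; rewrite exprn_ge0.
rewrite big_ord_recr/= mulrDr.
have := @exprS_sub_le n j.+1%:R j%:R; rewrite ler0n ler_nat leqnSn => /(_ isT).
rewrite -[j.+1%:R - _]natrB// subSnn mulr1; lra.
Qed.

Lemma le_sum_pow_real (n j : nat) (x : R) : j%:R <= x ->
  x ^+ n.+1 <= n.+1%:R * (\sum_(k < j.+1) k%:R ^+ n + (x - j%:R) * x ^+ n).
Proof.
move=> jx; have := le_sum_pow n j.
have := @exprS_sub_le n x j%:R; rewrite ler0n jx => /(_ isT).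
by rewrite mulrDr; lra.
Qed.

End PowerSum.

(** * Discrete averages of functions above a tent-shaped power profile *)

Section TentSum.
Context {R : realType}.

(** [W] dominates a profile with peak [M] at [s] that decays like an [n]-th power to 0 at both ends
    of [[0, 1]]; its integral is [M / (n + 1)]. The [- 1] pays for the grid cell containing [s]. The
    hypotheses are cleared of denominators so that [s = 0] and [s = 1] are allowed. *)
Lemma tent_sum (n N : nat) (s M : R) (W : nat -> R) :
  0 <= s <= 1 -> (0 < N)%N -> 0 <= M -> (forall k, (k <= N)%N -> 0 <= W k) ->
  (forall k, (k <= N)%N -> k%:R / N%:R <= s ->
     (k%:R / N%:R) ^+ n * M <= s ^+ n * W k) ->
  (forall k, (k <= N)%N -> s <= k%:R / N%:R ->
     (1 - k%:R / N%:R) ^+ n * M <= (1 - s) ^+ n * W k) ->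
  (N%:R / n.+1%:R - 1) * M <= \sum_(k < N.+1) W k.
Proof.
move=> /andP[s0 s1] N0 M0 W0 Wl Wr.
have N0' : 0 < N%:R :> R by rewrite ltr0n.
have Nn0 : N%:R != 0 :> R by rewrite gt_eqF.
pose x := N%:R * s; have x0 : 0 <= x by rewrite mulr_ge0.
have xN : x <= N%:R by rewrite ler_piMr.
pose j := Num.truncn x.
have /andP[jx xj] : j%:R <= x < j.+1%:R by exact: truncn_itv.
have jN : (j <= N)%N by rewrite -(ler_nat R) (le_trans jx).
have Wl' k : (k <= j)%N -> k%:R ^+ n * M <= x ^+ n * W k.
  move=> kj; have kN := leq_trans kj jN.
  have kx : k%:R <= x by rewrite (le_trans _ jx)// ler_nat.
  have := Wl k kN; rewrite ler_pdivrMr// mulrC => /(_ kx).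
  have -> : k%:R ^+ n * M = N%:R ^+ n * ((k%:R / N%:R) ^+ n * M).
    by rewrite mulrA -exprMn mulrCA divff// mulr1.
  by rewrite /x [(N%:R * s) ^+ n]exprMn -[X in _ -> _ <= X]mulrA ler_pM2l// exprn_gt0.
have Wr' k : (j < k <= N)%N -> (N - k)%:R ^+ n * M <= (N%:R - x) ^+ n * W k.
  move=> /andP[jk kN].
  have kx : x <= k%:R by rewrite (le_trans (ltW xj))// ler_nat.
  have := Wr k kN; rewrite ler_pdivlMr// mulrC => /(_ kx).
  have -> : (N - k)%:R ^+ n * M = N%:R ^+ n * ((1 - k%:R / N%:R) ^+ n * M).
    by rewrite mulrA -exprMn mulrBr mulr1 mulrCA divff// mulr1 natrB.
  have -> : N%:R - x = N%:R * (1 - s) by rewrite /x mulrBr mulr1.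
  rewrite [(N%:R * (1 - s)) ^+ n]exprMn -[X in _ -> _ <= X]mulrA.
  by rewrite ler_pM2l// exprn_gt0.
have L : (x / n.+1%:R - (x - j%:R)) * M <= \sum_(k < j.+1) W k.
  (* At [x = 0] one cannot divide by [x ^ n], but the left-hand side is then 0. *)
  have [x_eq0|xn0] := eqVneq x 0.
    rewrite x_eq0 mul0r sub0r.
    have -> : j%:R = 0 :> R by apply/eqP; rewrite eq_le ler0n -x_eq0 jx.
    rewrite subrr oppr0 mul0r sumr_ge0// => k _; apply: W0.
    by rewrite (leq_trans _ jN)// -ltnS.
  have xgt0 : 0 < x by rewrite lt_neqAle eq_sym xn0.
  have xn : 0 < x ^+ n by rewrite exprn_gt0.
  rewrite -(ler_pM2l xn) mulr_sumr.
  apply: (@le_trans _ _ (\sum_(k < j.+1) k%:R ^+ n * M)); last first.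
    by apply: ler_sum => k _; apply: Wl'; rewrite -ltnS.
  rewrite -mulr_suml mulrA ler_wpM2r//.
  have := le_sum_pow_real n j x jx; rewrite -ler_pdivrMl// exprS.
  by move: (\sum_(_ < _) _) (_ ^+ n) (n.+1%:R^-1) => S p c; lra.
(* If [j = N] then [s = 1] and no grid point lies to the right of the peak. *)
have [jeqN|jltN] : j = N \/ (j < N)%N.
  by move: jN; rewrite leq_eqVlt => /orP[/eqP|]; [left|right].
  have xE : x = N%:R by apply/eqP; rewrite eq_le xN -jeqN jx.
  move: L; rewrite jeqN xE subrr subr0 => H; apply: le_trans H.
  by rewrite ler_wpM2r// gerBl.
(* Reflection [k -> N - k] turns the right side into a left side with peak at [y]. The two losses
   [x - j] and [y - i] add up to 1. *)
pose i := (N - j.+1)%N; pose y := N%:R - x.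
have iE : i%:R = N%:R - j%:R - 1 :> R by rewrite natrB// -natr1 opprD addrA.
have iy : i%:R <= y by rewrite iE /y; move: xj; rewrite -natr1; lra.
have U : (y / n.+1%:R - (y - i%:R)) * M <= \sum_(k < i.+1) W (N - k)%N.
  have [y_eq0|yn0] := eqVneq y 0.
    rewrite y_eq0 mul0r sub0r.
    have -> : i%:R = 0 :> R by apply/eqP; rewrite eq_le ler0n -y_eq0 iy.
    by rewrite subrr oppr0 mul0r sumr_ge0// => k _; apply: W0; rewrite leq_subr.
  have ygt0 : 0 < y by rewrite lt_neqAle eq_sym yn0 /y subr_ge0.
  have yn : 0 < y ^+ n by rewrite exprn_gt0.
  rewrite -(ler_pM2l yn) mulr_sumr.
  apply: (@le_trans _ _ (\sum_(k < i.+1) k%:R ^+ n * M)); last first.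
    apply: ler_sum => k _.
    have kN : (k <= N)%N by rewrite (leq_trans (leq_ord k))// leq_subr.
    have := Wr' (N - k)%N; rewrite subKn//; apply; rewrite leq_subr andbT.
    by rewrite ltn_subRL addnC -addSn -leq_subRL//; exact: leq_ord.
  rewrite -mulr_suml mulrA ler_wpM2r//.
  have := le_sum_pow_real n i y iy; rewrite -ler_pdivrMl// exprS.
  by move: (\sum_(_ < _) _) (_ ^+ n) (n.+1%:R^-1) => S p c; lra.
have -> : \sum_(k < N.+1) W k =
    \sum_(k < j.+1) W k + \sum_(k < i.+1) W (N - k)%N.
  rewrite -!(big_mkord xpredT) (@big_cat_nat _ _ _ j.+1)//=.
  congr (_ + _).
  rewrite -[RHS](big_mkord xpredT (fun k => W (N - k)%N)) [RHS]big_nat_rev/=.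
  have iS : (N.+1 - j.+1)%N = i.+1 by rewrite /i subSS subnSK.
  rewrite add0n -{1}[j.+1]add0n big_addn !big_mkord iS.
  apply: eq_bigr => k _; congr W; move: (nat_of_ord k) (leq_ord k) => q qi.
  by rewrite subSS /i -subnDA subKn 1?addnC// addnC -leq_subRL.
rewrite /y in U; rewrite iE in U.
have := lerD L U; rewrite -mulrDl; apply: le_trans; rewrite ler_wpM2r//.
by move: (n.+1%:R^-1) => c; lra.
Qed.

End TentSum.

(** * Products of affine functions along a segment *)

Section Segment.
Context {R : realType}.

(** A nonnegative affine function at [t <= s] is at least [t / s] times its value at [s], and
    symmetrically on the other side. The product of [n] of them therefore lies above a tent with
    peak at [s]. *)
Lemma segment_sum (n N : nat) (s : R) (z0 z1 : 'I_n -> R) :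
  (0 < N)%N -> 0 <= s <= 1 -> (forall i, 0 <= z0 i) -> (forall i, 0 <= z1 i) ->
  (N%:R / n.+1%:R - 1) * \prod_i ((1 - s) * z0 i + s * z1 i) <=
  \sum_(k < N.+1) \prod_i ((1 - k%:R / N%:R) * z0 i + k%:R / N%:R * z1 i).
Proof.
move=> N0 s01 z0_ge0 z1_ge0; have /andP[s0 s1] := s01.
have N0' : 0 < N%:R :> R by rewrite ltr0n.
have pos (t : R) i : 0 <= t <= 1 -> 0 <= (1 - t) * z0 i + t * z1 i.
  by move=> /andP[t0 t1]; rewrite addr_ge0// mulr_ge0// subr_ge0.
have kN01 k : (k <= N)%N -> 0 <= (k%:R / N%:R : R) <= 1.
  by move=> kN; rewrite divr_ge0//= ler_pdivrMr// mul1r ler_nat.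
have powE (a : R) (F : 'I_n -> R) : a ^+ n * \prod_i F i = \prod_i (a * F i).
  by rewrite big_split/= prodr_const card_ord.
apply: (@tent_sum _ n N s _
  (fun k => \prod_i ((1 - k%:R / N%:R) * z0 i + k%:R / N%:R * z1 i))) => //.
- by apply: prodr_ge0 => i _; exact: pos.
- by move=> k kN; apply: prodr_ge0 => i _; exact/pos/kN01.
- move=> k kN ks; rewrite !powE.
  have /andP[k0 k1] := kN01 k kN.
  apply: ler_prod => i _; rewrite mulr_ge0 ?pos//=.
  by have := z0_ge0 i; move: (z0 i) (z1 i) (k%:R / N%:R) ks {k0 k1} => u v t; nra.
- move=> k kN ks; rewrite !powE.
  have /andP[k0 k1] := kN01 k kN.
  apply: ler_prod => i _; rewrite mulr_ge0 ?pos ?subr_ge0//=.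
  by have := z1_ge0 i; move: (z0 i) (z1 i) (k%:R / N%:R) ks {k0 k1} => u v t; nra.
Qed.

End Segment.

(** * Geometry of the dual region and its grid *)

Section DualRegion.
Context {R : realType}.
Implicit Types (b : R -> R) (m : R) (l : R * R).

Definition dual_factor b m l (y : R) : R := 1 - l.1 * (y - m) - l.2 * b y.

Definition dual_region b m : set (R * R) :=
  [set l | 0 <= l.2 /\ forall y, 0 <= dual_factor b m l y].

Definition concave_fun b := forall x y t : R, 0 <= t <= 1 ->
  t * b x + (1 - t) * b y <= b (t * x + (1 - t) * y).

Lemma dual_region0 b m : dual_region b m (0, 0).
Proof. by split => //= y; rewrite /dual_factor/= !mul0r !subr0. Qed.

Lemma dual_factor_conv b m l l' (t y : R) :
  dual_factor b m ((1 - t) * l.1 + t * l'.1, (1 - t) * l.2 + t * l'.2) y =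
  (1 - t) * dual_factor b m l y + t * dual_factor b m l' y.
Proof. by rewrite /dual_factor/=; ring. Qed.

Lemma dual_region_conv b m l l' (t : R) : 0 <= t <= 1 ->
  dual_region b m l -> dual_region b m l' ->
  dual_region b m ((1 - t) * l.1 + t * l'.1, (1 - t) * l.2 + t * l'.2).
Proof.
move=> /andP[t0 t1] [l0 lp] [l0' lp']; split => [|y].
  by rewrite /= addr_ge0// mulr_ge0// subr_ge0.
by rewrite dual_factor_conv addr_ge0// mulr_ge0// subr_ge0.
Qed.

Lemma dual_region_le b m l : 0 < b m -> dual_region b m l -> l.2 <= (b m)^-1.
Proof.
move=> bm [_ /(_ m)]; rewrite /dual_factor subrr mulr0 subr0 subr_ge0 => H.
by rewrite -[X in _ <= X]mul1r ler_pdivlMr.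
Qed.

(* A supergradient of [b] at [m] yields a point of the region at the maximal
   height [1 / b m]. *)
Lemma dual_region_top b m : concave_fun b -> 0 < b m ->
  exists t, dual_region b m (t, (b m)^-1).
Proof.
move=> cb bm; pose c y := 1 - b y / b m.
(* The factor at [y] for the multiplier [(t, 1 / b m)] is [c y - t * (y - m)]: points left of [m]
   bound [t] from below, points right of [m] from above. *)
pose A := [set a | exists2 y, y < m & a = c y / (y - m)].
pose C := [set a | exists2 y, m < y & a = c y / (y - m)].
have [t [At Ct]] : exists t, (forall a, A a -> a <= t) /\ (forall a, C a -> t <= a).
  apply: exists_between.
  - by exists (c (m - 1) / (m - 1 - m)), (m - 1) => //; lra.
  - by exists (c (m + 1) / (m + 1 - m)), (m + 1) => //; lra.
  - move=> _ _ [y ym ->] [z mz ->].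
    have zy : 0 < z - y by lra.
    (* The weight that writes [m] as a mixture of [y] and [z]. *)
    pose t := (z - m) / (z - y).
    have t01 : 0 <= t <= 1.
      by rewrite divr_ge0 ?subr_ge0 ?(ltW mz) ?(ltW (lt_trans ym mz))//= ler_pdivrMr//; lra.
    have := cb y z t t01.
    have -> : t * y + (1 - t) * z = m by rewrite /t; field; rewrite gt_eqF.
    have -> : t * b y + (1 - t) * b z = ((z - m) * b y + (m - y) * b z) / (z - y).
      by rewrite /t; field; rewrite gt_eqF.
    rewrite ler_pdivrMr// => H.
    have y0 : 0 < m - y by lra.
    have z0 : 0 < z - m by lra.
    have yn0 : y - m != 0 by rewrite lt_eqF// subr_lt0.
    pose D := b m * (m - y) * (z - m).
    have D0 : 0 < D by rewrite !mulr_gt0.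
    have -> : c y / (y - m) = ((b y - b m) * (z - m)) / D.
      by rewrite /c /D; field; rewrite yn0 !gt_eqF.
    have -> : c z / (z - m) = ((b m - b z) * (m - y)) / D.
      by rewrite /c /D; field; rewrite !gt_eqF.
    by rewrite ler_pM2r ?invr_gt0//; lra.
exists t; split => [|y] /=; first by rewrite invr_ge0 ltW.
rewrite /dual_factor/= [_ * b y]mulrC.
suff : t * (y - m) <= c y by rewrite /c; lra.
have [ym|ym|->] := ltgtP y m.
- have := At _ (ex_intro2 _ _ y ym erefl).
  by rewrite -mulrNN -invrN ler_pdivrMr ?oppr_gt0 ?subr_lt0//; lra.
- have := Ct _ (ex_intro2 _ _ y ym erefl).
  by rewrite ler_pdivlMr ?subr_gt0.
- by rewrite subrr mulr0 /c divff ?subrr// gt_eqF.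
Qed.

(** A horizontal slice is an intersection of closed half-lines, one per [y]; those of [y = m + 1]
    and [y = m - 1] bound it on both sides. A nonempty slice thus contains its endpoints. *)
Lemma dual_region_slice b m (h : R) :
  let S := [set a | dual_region b m (a, h)] in S !=set0 ->
  [/\ S (inf S), S (sup S) & forall a, S a -> inf S <= a <= sup S].
Proof.
move=> S S0; have [a0 Sa0] := S0.
have leS a y : S a -> a * (y - m) <= 1 - h * b y.
  by move=> [_ /(_ y)]; rewrite /dual_factor/=; lra.
have uS : has_ubound S.
  by exists (1 - h * b (m + 1)) => a Sa; have := leS a (m + 1) Sa; lra.
have lS : has_lbound S.
  by exists (- (1 - h * b (m - 1))) => a Sa; have := leS a (m - 1) Sa; lra.
have inI a : S a -> inf S <= a <= sup S.
  by move=> Sa; rewrite ge_inf// ub_le_sup.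
have /andP[i0 s0] := inI _ Sa0.
have h0 : 0 <= h by case: Sa0.
have SI a : (forall y, a * (y - m) <= 1 - h * b y) -> S a.
  by move=> H; split => // y; rewrite /dual_factor/=; have := H y; lra.
split => //; apply: SI => y; have := leS _ y Sa0; have [ym|ym|->] := ltgtP y m.
- move=> _; rewrite -ler_ndivrMr ?subr_lt0//; apply: lb_le_inf => // a Sa.
  by rewrite ler_ndivrMr ?subr_lt0// leS.
- by nra.
- by rewrite subrr !mulr0.
- by nra.
- move=> _; rewrite -ler_pdivlMr ?subr_gt0//; apply: ge_sup => // a Sa.
  by rewrite ler_pdivlMr ?subr_gt0// leS.
- by rewrite subrr !mulr0.
Qed.

(* The grid consists of [N.+1] horizontal slices of the region with [N.+1]
   equidistant points each: [segment_sum] is used within a slice and [tent_sum]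
   across the slices. *)
Lemma dual_region_grid b m (N : nat) : concave_fun b -> 0 < b m -> (0 < N)%N ->
  exists2 g : nat -> nat -> R * R,
    (forall j k, (j <= N)%N -> (k <= N)%N -> dual_region b m (g j k)) &
    forall (n : nat) (y : 'I_n -> R) l, (0 < n)%N -> (n < N)%N ->
    dual_region b m l ->
    (N%:R / n.+1%:R - 1) ^+ 2 * \prod_i dual_factor b m l (y i) <=
    \sum_(j < N.+1) \sum_(k < N.+1) \prod_i dual_factor b m (g j k) (y i).
Proof.
move=> cb bm N0; have [t topD] := dual_region_top b m cb bm.
have N0' : 0 < N%:R :> R by rewrite ltr0n.
pose S h := [set a | dual_region b m (a, h)].
pose lo h := inf (S h); pose hi h := sup (S h).
(* Equidistant heights from 0 to [1 / b m], the maximal height in the region. *)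
pose H j := j%:R / N%:R / b m.
pose g j k := (((1 - k%:R / N%:R) * lo (H j) + k%:R / N%:R * hi (H j)), H j).
have kN01 k : (k <= N)%N -> 0 <= (k%:R / N%:R : R) <= 1.
  by move=> kN; rewrite divr_ge0//= ler_pdivrMr// mul1r ler_nat.
have S_ex j : (j <= N)%N -> S (H j) !=set0.
  (* The point at height [H j] on the segment from the origin to the top point. *)
  move=> jN; exists (j%:R / N%:R * t).
  have := dual_region_conv b m (0, 0) (t, (b m)^-1) _ (kN01 j jN) (dual_region0 b m) topD.
  by rewrite /= !mulr0 !add0r.
have gE j k : g j k = ((1 - k%:R / N%:R) * (lo (H j), H j).1 + k%:R / N%:R * (hi (H j), H j).1,
    (1 - k%:R / N%:R) * (lo (H j), H j).2 + k%:R / N%:R * (hi (H j), H j).2).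
  by rewrite /g/=; congr pair; ring.
exists g => [j k jN kN|n y l n0 nN lD].
  have [loD hiD _] := dual_region_slice b m (H j) (S_ex j jN).
  by rewrite gE; apply: dual_region_conv => //; exact: kN01.
pose c : R := N%:R / n.+1%:R - 1.
have c0 : 0 <= c by rewrite /c subr_ge0 ler_pdivlMr ?ltr0n// mul1r ler_nat.
pose Z l := \prod_i dual_factor b m l (y i).
have Z0 l' : dual_region b m l' -> 0 <= Z l'.
  by move=> [_ l'0]; apply: prodr_ge0.
pose W j := \sum_(k < N.+1) Z (g j k).
have W0 j : (j <= N)%N -> 0 <= W j.
  move=> jN; apply: sumr_ge0 => k _; apply: Z0.
  have [loD hiD _] := dual_region_slice b m (H j) (S_ex j jN).
  by rewrite gE; apply: dual_region_conv => //; apply: kN01; rewrite -ltnS.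
have WZ j a : (j <= N)%N -> dual_region b m (a, H j) -> c * Z (a, H j) <= W j.
  move=> jN aD.
  have [loD hiD /(_ _ aD)/andP[la ah]] := dual_region_slice b m (H j) (S_ex j jN).
  (* The relative position of [a] in its slice; in a one-point slice any [s] serves, and 0 is
     taken. *)
  have [s s01 aE] : exists2 s, 0 <= s <= 1 & a = (1 - s) * lo (H j) + s * hi (H j).
    have [lh|lh] := ltP (lo (H j)) (hi (H j)).
      exists ((a - lo (H j)) / (hi (H j) - lo (H j))).
        by rewrite divr_ge0 ?subr_ge0 ?(ltW lh)//= ler_pdivrMr ?subr_gt0// mul1r lerB.
      by field; rewrite gt_eqF// subr_gt0.
    by exists 0; [rewrite lexx ler01|rewrite /lo /hi in lh *; lra].
  have -> : (a, H j) = ((1 - s) * (lo (H j), H j).1 + s * (hi (H j), H j).1,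
      (1 - s) * (lo (H j), H j).2 + s * (hi (H j), H j).2).
    by rewrite /= -aE; congr pair; ring.
  rewrite /W /Z.
  under eq_bigr do rewrite dual_factor_conv.
  under [X in _ <= X]eq_bigr do (under eq_bigr do rewrite gE dual_factor_conv).
  by apply: segment_sum => // i; [case: loD|case: hiD].
(* The height of [l] relative to the maximal one, hence the location of the peak across slices. *)
rewrite expr2 -mulrA; pose s := l.2 * b m.
have [l0 _] := lD.
have s01 : 0 <= s <= 1.
  rewrite mulr_ge0 ?(ltW bm)//= -ler_pdivlMr// mul1r.
  exact: dual_region_le.
have /andP[s0 s1] := s01.
have lE : l.2 = s / b m by rewrite /s mulfK// gt_eqF.
have powE (a : R) l' : a ^+ n * Z l' = \prod_i (a * dual_factor b m l' (y i)).
  by rewrite big_split/= prodr_const card_ord.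
apply: (@tent_sum _ n N s _ W) => //; first by rewrite mulr_ge0// Z0.
- move=> j jN js; have /andP[j0 j1] := kN01 j jN.
  (* At [s = 0] both sides vanish, because [0 < n] gives [0 ^ n = 0]; likewise below at [s = 1]. *)
  have [s_eq0|sn0] := eqVneq s 0.
    have -> : j%:R / N%:R = 0 :> R by apply/eqP; rewrite eq_le j0 -s_eq0 js.
    by rewrite s_eq0 expr0n gtn_eqF// !mul0r.
  have sgt0 : 0 < s by rewrite lt_neqAle eq_sym sn0.
  (* For slices below [l], the comparison point lies on the segment from the origin to [l]. Dropping
     the nonnegative contribution of the origin leaves [a] times the factor of [l]. *)
  pose a := j%:R / N%:R / s.
  have a01 : 0 <= a <= 1 by rewrite divr_ge0//= ler_pdivrMr// mul1r.
  have /andP[a0 a1] := a01.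
  have muD := dual_region_conv b m (0, 0) l a a01 (dual_region0 b m) lD.
  have muE : ((1 - a) * (0 : R, 0 : R).1 + a * l.1,
      (1 - a) * (0 : R, 0 : R).2 + a * l.2) = (a * l.1, H j).
    rewrite /= !mulr0 !add0r lE; congr (_, _); rewrite /a /H.
    by move: (j%:R / N%:R) => q; field; rewrite sn0 gt_eqF.
  have := WZ j (a * l.1) jN; rewrite -muE => /(_ muD) {}WZ.
  have -> : j%:R / N%:R = s * a by rewrite /a [RHS]mulrC divfK.
  rewrite exprMn -mulrA ler_wpM2l ?exprn_ge0// mulrCA.
  apply: (le_trans _ WZ); rewrite ler_wpM2l// powE.
  apply: ler_prod => i _; have [_ /(_ (y i)) lp] := lD.
  rewrite mulr_ge0// andTb dual_factor_conv lerDr.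
  apply: mulr_ge0; first by rewrite subr_ge0.
  by have [_] := dual_region0 b m; apply.
- move=> j jN js; have /andP[j0 j1] := kN01 j jN.
  have [s_eq1|sn1] := eqVneq s 1.
    have -> : j%:R / N%:R = 1 :> R by apply/eqP; rewrite eq_le j1 (le_trans _ js)// s_eq1.
    by rewrite s_eq1 subrr expr0n gtn_eqF// !mul0r.
  have sgt0 : 0 < 1 - s by rewrite subr_gt0 lt_neqAle sn1.
  (* For slices above [l], the segment from the top point to [l] is used in the same way. *)
  pose a := (1 - j%:R / N%:R) / (1 - s).
  have a01 : 0 <= a <= 1.
    by rewrite divr_ge0 ?subr_ge0//= ler_pdivrMr// mul1r lerB.
  have /andP[a0 a1] := a01.
  have muD := dual_region_conv b m (t, (b m)^-1) l a a01 topD lD.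
  have muE : ((1 - a) * (t, (b m)^-1).1 + a * l.1, (1 - a) * (t, (b m)^-1).2 + a * l.2) =
      ((1 - a) * t + a * l.1, H j).
    rewrite /= lE; congr (_, _); rewrite /a /H.
    by move: (j%:R / N%:R) => q; field; rewrite !gt_eqF.
  have := WZ j ((1 - a) * t + a * l.1) jN; rewrite -muE => /(_ muD) {}WZ.
  have -> : 1 - j%:R / N%:R = (1 - s) * a by rewrite /a [RHS]mulrC divfK// gt_eqF.
  rewrite exprMn -mulrA ler_wpM2l ?exprn_ge0 ?subr_ge0// mulrCA.
  apply: (le_trans _ WZ); rewrite ler_wpM2l// powE.
  apply: ler_prod => i _; have [_ /(_ (y i)) lp] := lD.
  rewrite mulr_ge0// andTb dual_factor_conv lerDr.
  apply: mulr_ge0; first by rewrite subr_ge0.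
  by have [_] := topD; apply.
Qed.

End DualRegion.

(** * Expectations of products of independent variables *)

Section Independence.
Context d (T : measurableType d) (R : realType).
Local Open Scope ereal_scope.

Import HBNNSimple.

(** Here [nu] is the image under [Y] of the measure with density [W]. The hypothesis on indicators
    extends to simple functions by linearity and to [phi] by monotone convergence. *)
Lemma ge0_integral_comp_weight d' (U : measurableType d')
    (mu : {measure set T -> \bar R}) (nu : {measure set U -> \bar R})
    (Y : T -> U) (W : T -> R) :
  measurable_fun setT Y -> measurable_fun setT W -> (forall t, 0 <= W t)%R ->
  (forall A, measurable A -> \int[mu]_t (\1_A (Y t) * W t)%:E = nu A) ->
  forall phi : U -> R, measurable_fun setT phi -> (forall x, 0 <= phi x)%R ->
  \int[mu]_t (phi (Y t) * W t)%:E = \int[nu]_x (phi x)%:E.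
Proof.
move=> mY mW W0 muW phi mphi phi0.
have mEphi : measurable_fun setT (EFin \o phi) by exact/measurable_EFinP.
pose h := nnsfun_approx measurableT mEphi.
have h_cvg x : (h n x)%:E @[n --> \oo] --> (phi x)%:E.
  by apply: (@cvg_nnsfun_approx _ _ _ _ measurableT _ mEphi) => // y _; rewrite lee_fin.
have h_nd x a b : (a <= b)%N -> (h a x <= h b x)%R.
  by move=> ab; exact/lefP/(nd_nnsfun_approx measurableT mEphi).
have -> : \int[nu]_x (phi x)%:E = lim (\int[nu]_x (h n x)%:E @[n --> \oo]).
  have fE x : (phi x)%:E = lim ((h n x)%:E @[n --> \oo]) by apply/esym/cvg_lim.
  under eq_integral do rewrite fE.
  apply: monotone_convergence => //.
  - by move=> n; exact/measurable_EFinP.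
  - by move=> n x _; rewrite lee_fin.
  - by move=> x _ a b ab; rewrite lee_fin h_nd.
have -> : \int[mu]_t (phi (Y t) * W t)%:E =
    lim (\int[mu]_t ((h n (Y t))%:E * (W t)%:E) @[n --> \oo]).
  have fE t : (phi (Y t) * W t)%:E = lim ((h n (Y t))%:E * (W t)%:E @[n --> \oo]).
    by apply/esym/cvg_lim => //; rewrite EFinM; apply: cvgeZr.
  under eq_integral do rewrite fE.
  apply: monotone_convergence => //.
  - move=> n; apply/measurable_EFinP/measurable_funM => //.
    exact: measurableT_comp.
  - by move=> n x _; rewrite -EFinM lee_fin mulr_ge0.
  - by move=> x _ a b ab; rewrite -!EFinM lee_fin ler_wpM2r// h_nd.
suff suf n : \int[mu]_t ((h n (Y t))%:E * (W t)%:E) = \int[nu]_x (h n x)%:E.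
  by under eq_fun do rewrite suf.
have mI (r : R) : measurable (h n @^-1` [set r]).
  by rewrite -[X in measurable X]setTI; exact: measurable_funP.
transitivity (\int[nu]_x
   (\sum_(y \in range (h n)) (y * \1_(h n @^-1` [set y]) x)%:E)); last first.
  by apply: eq_integral => t tE; rewrite /= fimfunE -fsumEFin.
rewrite ge0_integral_fsum//; last 2 first.
  - by move=> r; apply/measurable_EFinP/measurable_funM.
  - by move=> m y Ey; exact: nnfun_muleindic_ge0.
transitivity (\int[mu]_t (\sum_(y \in range (h n))
    (y * \1_(h n @^-1` [set y]) (Y t))%:E * (W t)%:E)).
  apply: eq_integral => t _.
  rewrite -ge0_mule_fsuml => [|y]; last exact: nnfun_muleindic_ge0.
  by rewrite fsumEFin // -(fimfunE _ (Y t)).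
have mIY (r : R) : measurable_fun setT (fun t => \1_(h n @^-1` [set r]) (Y t) : R)%R.
  exact: measurableT_comp.
rewrite ge0_integral_fsum//; last 2 first.
  - by move=> y; apply/measurable_EFinP/measurable_funM => //; exact: measurable_funM.
  - move=> m y Ey; apply: mule_ge0; last by rewrite lee_fin.
    exact: nnfun_muleindic_ge0.
apply: eq_fsbigr => r /[!inE] -[x _ <-].
under eq_integral do rewrite -EFinM -mulrA EFinM.
rewrite ge0_integralZl//; last 3 first.
- by apply/measurable_EFinP; exact: measurable_funM.
- by move=> t _; rewrite lee_fin mulr_ge0.
- by rewrite lee_fin.
under [RHS]eq_integral do rewrite EFinM.
rewrite ge0_integralZl//; last 2 first.
- exact/measurable_EFinP.
- by rewrite lee_fin.
by rewrite muW// integral_indic// setIT.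
Qed.

Lemma independent_integral_prod (P : probability T R) (kappa : probability R R)
    (n : nat) (X : nat -> {RV P >-> R}) :
  mutually_independent n X ->
  (forall i A, (i < n)%N -> measurable A -> P (X i @^-1` A) = kappa A) ->
  forall (psi : 'I_n -> R -> R) (e : 'I_n -> R),
  (forall i, measurable_fun setT (psi i)) -> (forall i x, 0 <= psi i x)%R ->
  (forall i, \int[kappa]_x (psi i x)%:E = (e i)%:E) ->
  \int[P]_t (\prod_(i < n) psi i (X i t))%:E = (\prod_(i < n) e i)%:E.
Proof.
move=> indep law psi e mpsi psi0 psie.
(* Coordinates are released one at a time: those of index at least [k] are still indicators. For
   [k = 0] this is independence itself; for [k = n] it is the claim. *)
suff H k : (k <= n)%N -> forall (psi : 'I_n -> R -> R) (e : 'I_n -> R),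
  (forall i, measurable_fun setT (psi i)) -> (forall i x, 0 <= psi i x)%R ->
  (forall i, \int[kappa]_x (psi i x)%:E = (e i)%:E) ->
  (forall i : 'I_n, (k <= i)%N -> exists2 A, measurable A & psi i = \1_A) ->
  \int[P]_t (\prod_(i < n) psi i (X i t))%:E = (\prod_(i < n) e i)%:E.
  by apply: (H n) => // i; rewrite leqNgt ltn_ord.
elim: k => [_|k IH kn] {mpsi psi0 psie}{}psi {}e mpsi psi0 psie psiA.
  have {}psiA i : {A | measurable A & psi i = \1_A} by exact/cid2/psiA.
  pose A i := s2val (psiA i).
  have mA i : measurable (A i) := s2valP (psiA i).
  have psiE i : psi i = \1_(A i) := s2valP' (psiA i).
  have := indep A mA.
  under [RHS]eq_bigr => i _.
    rewrite law//.
    have -> : kappa (A i) = (e i)%:E.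
      by rewrite -psie psiE integral_indic// setIT.
    over.
  rewrite prodEFin => <-.
  have mB : measurable (\big[setI/setT]_(i < n) (X i @^-1` A i)).
    by apply: bigsetI_measurable => i _; rewrite -[X in measurable X]setTI;
      exact: measurable_funP.
  rewrite -[X in P X]setIT -integral_indic//.
  apply: eq_integral => t _; congr EFin.
  under eq_bigr do rewrite psiE.
  rewrite !indicE.
  elim/big_rec2: _ => [|i b B _ ->]; first by rewrite in_setT.
  by rewrite indicE in_setI -natrM mulnb/=; congr ((_ && _)%:R); apply/idP/idP; rewrite !inE.
pose k' := Ordinal kn.
pose W t := (\prod_(i < n | i != k') psi i (X i t))%R.
pose c := (\prod_(i < n | i != k') e i)%R.
have e0 i : (0 <= e i)%R.
  by rewrite -lee_fin -psie integral_ge0// => x _; rewrite lee_fin.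
have c0 : (0 <= c)%R by rewrite prodr_ge0.
transitivity (\int[P]_t (psi k' (X k t) * W t)%:E).
  by apply: eq_integral => t _; rewrite (bigD1 k').
have mX i : measurable_fun setT (X i) by [].
(* The product [W] of the other coordinates is the weight, and the weighted law of [X k] is [c]
   times [kappa]. *)
have -> := @ge0_integral_comp_weight _ _ P (mscale (NngNum c0) kappa) (X k) W.
- rewrite ge0_integral_mscale//=; last 2 first.
  + exact/measurable_EFinP.
  + by move=> x _; rewrite lee_fin.
  by rewrite psie -EFinM mulrC (bigD1 k').
- by [].
- rewrite (_ : W = fun t => (\prod_(i <- [seq i <- index_enum 'I_n | i != k'])
      psi i (X i t))%R); last by apply/funext => t; rewrite big_filter.
  by apply: measurable_prod => i _; exact: measurableT_comp.
- by move=> t; rewrite prodr_ge0.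
- move=> A mA.
  (* With an indicator in place [k'], the induction hypothesis applies and identifies the weighted
     law. *)
  pose psi' i := if i == k' then \1_A else psi i.
  pose e' i := if i == k' then fine (kappa A) else e i.
  transitivity (\int[P]_t (\prod_(i < n) psi' i (X i t))%:E).
    apply: eq_integral => t _; rewrite (bigD1 k')//= /psi' eqxx; congr (_ * _)%:E.
    by apply: eq_bigr => i /negPf ->.
  rewrite (IH (ltnW kn) psi' e').
  + rewrite (bigD1 k')//= /e' eqxx /mscale/= muleC EFinM fineK ?fin_num_measure//.
    by congr (_ * _%:E); apply: eq_bigr => i /negPf ->.
  + by move=> i; rewrite /psi'; case: ifP.
  + by move=> i x; rewrite /psi'; case: ifP.
  + move=> i; rewrite /psi' /e'; case: ifP => // _.
    by rewrite integral_indic// setIT fineK ?fin_num_measure.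
  + move=> i ki; rewrite /psi'; case: ifPn => [_|ik]; first by exists A.
    apply: psiA; rewrite ltn_neqAle ki andbT eq_sym.
    by apply: contra ik => /eqP ik; apply/eqP/val_inj.
- exact: mpsi.
- exact: psi0.
Qed.

End Independence.

(** * Duality over finitely supported measures *)

Section PointMassDuality.
Context {R : realType}.

(** The tangent of [ln] at the mixture [c] lies above [ln], and its linear terms cancel in the
    average. *)
Lemma ln_conv_le (a b t : R) : 0 < a -> 0 < b -> 0 <= t <= 1 ->
  t * ln a + (1 - t) * ln b <= ln (t * a + (1 - t) * b).
Proof.
move=> a0 b0 /andP[t0 t1]; set c := t * a + (1 - t) * b.
have c0 : 0 < c by rewrite /c; have [t_lt|t_ge] := ltP t (1 / 2); nra.
have ln_le x : 0 < x -> ln x - ln c <= x / c - 1.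
  move=> x0; rewrite -ln_div ?posrE// -[X in ln X](subrK 1) addrC le_ln1Dx//.
  by rewrite ltrBrDr addNr divr_gt0.
have Ha : t * (ln a - ln c) <= t * (a / c - 1) by rewrite ler_wpM2l// ln_le.
have Hb : (1 - t) * (ln b - ln c) <= (1 - t) * (b / c - 1).
  by rewrite ler_wpM2l ?subr_ge0// ln_le.
have E : t * (a / c - 1) + (1 - t) * (b / c - 1) = 0.
  have -> : t * (a / c - 1) + (1 - t) * (b / c - 1) = c / c - 1 by rewrite /c; ring.
  by rewrite divff ?subrr// gt_eqF.
by lra.
Qed.

Variables (n : nat) (xs : 'I_n -> R).

(* [x.1] gives the masses at the sample points (equal at equal points), [x.2]
   lists further weighted points. *)
Definition point_sum (phi : R -> R) (x : (R -> R) * seq (R * R)) : R :=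
  \sum_i x.1 (xs i) * phi (xs i) + \sum_(p <- x.2) p.1 * phi p.2.

(** Masses at sample points are strictly positive because [ln] takes the default value 0 elsewhere,
    which would break concavity of [log_mass]. *)
Definition point_masses : set ((R -> R) * seq (R * R)) :=
  [set x | (forall y, 0 < x.1 y) /\ all (fun p => 0 <= p.1) x.2].

Definition log_mass (x : (R -> R) * seq (R * R)) : R := \sum_i ln (x.1 (xs i)).

(** Sample masses are mixed pointwise and the rescaled lists concatenated, so every [point_sum] is
    affine in the mixture. *)
Lemma point_masses_conv x y t : point_masses x -> point_masses y -> 0 <= t <= 1 ->
  exists z, [/\ point_masses z,
    t * log_mass x + (1 - t) * log_mass y <= log_mass z &
    forall phi, point_sum phi z = t * point_sum phi x + (1 - t) * point_sum phi y].
Proof.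
case: x y => [h r] [h' r'] [/= h0 r0] [/= h0' r0'] t01; have /andP[t0 t1] := t01.
exists (fun y => t * h y + (1 - t) * h' y,
  [seq (t * p.1, p.2) | p <- r] ++ [seq ((1 - t) * p.1, p.2) | p <- r']).
split.
- split => /= [y|].
    by have := h0 y; have := h0' y; have [t_lt|t_ge] := ltP t (1 / 2); nra.
  rewrite all_cat !all_map; apply/andP; split; apply/allP => p pr /=.
    by rewrite mulr_ge0//; exact: (allP r0).
  by rewrite mulr_ge0 ?subr_ge0//; exact: (allP r0').
- rewrite /log_mass/= !mulr_sumr -big_split/=.
  by apply: ler_sum => i _; exact: ln_conv_le.
- move=> phi; rewrite /point_sum/= big_cat/= !big_map/=.
  under [X in _ + (X + _)]eq_bigr do rewrite -mulrA.
  under [X in _ + (_ + X)]eq_bigr do rewrite -mulrA.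
  rewrite -!mulr_sumr.
  under eq_bigr do rewrite mulrDl -!mulrA.
  by rewrite big_split/= -!mulr_sumr; ring.
Qed.

(** A Slater point: mass 1/2 at [y] and a small mass [e] at each sample. *)
Lemma point_masses_slater (a b : R -> R) y : 0 < a y -> 0 < b y ->
  exists x, [/\ point_masses x, point_sum (cst 1) x < 1,
    0 < point_sum a x & 0 < point_sum b x].
Proof.
move=> ay by0.
pose C := n%:R + \sum_i `|a (xs i)| + \sum_i `|b (xs i)|.
have Ca : 0 <= \sum_i `|a (xs i)| by apply: sumr_ge0.
have Cb : 0 <= \sum_i `|b (xs i)| by apply: sumr_ge0.
have n0 : 0 <= n%:R :> R by [].
have C0 : 0 < 1 + C by rewrite /C; lra.
pose d := Num.min 1 (Num.min (a y) (b y)).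
have d0 : 0 < d by rewrite !lt_min ltr01 ay by0.
have d1 : d <= 1 by rewrite /d ge_min lexx.
have da : d <= a y by rewrite /d !ge_min lexx orbT.
have db : d <= b y by rewrite /d !ge_min lexx !orbT.
(* With this [e] the samples perturb each of the three sums by less than [d / 2], which the mass at
   [y] can absorb. *)
pose e := d / 2 / (1 + C).
have e0 : 0 < e by rewrite !divr_gt0.
have eC : e * C < d / 2.
  have -> : d / 2 = e * (1 + C) by rewrite /e divfK// gt_eqF.
  by rewrite ltr_pM2l//; lra.
exists (cst e, [:: (1 / 2, y)]).
have le_abs (g : R -> R) : - (e * \sum_i `|g (xs i)|) <= \sum_i e * g (xs i).
  rewrite mulr_sumr -sumrN; apply: ler_sum => i _.
  by rewrite -mulrN ler_wpM2l ?(ltW e0)// lerNl -normrN ler_norm.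
have pE g : point_sum g (cst e, [:: (1 / 2, y)]) = \sum_i e * g (xs i) + g y / 2.
  by rewrite /point_sum big_seq1/= mulrC div1r.
move: eC; rewrite /C !mulrDr => eC.
have ea : 0 <= e * \sum_i `|a (xs i)| by rewrite mulr_ge0// ltW.
have eb : 0 <= e * \sum_i `|b (xs i)| by rewrite mulr_ge0// ltW.
have en : 0 <= e * n%:R by rewrite mulr_ge0// ltW.
split.
- by split => //=; rewrite divr_ge0.
- rewrite pE /= sumr_const card_ord mulr1 -[e *+ n]mulr_natr; lra.
- by rewrite pE; have := le_abs a; lra.
- by rewrite pE; have := le_abs b; lra.
Qed.

(** The right-hand side is a polynomial in [e], hence continuous at 0. *)
Lemma le_prod_limit (c : R) (z : 'I_n -> R) :
  (forall e, 0 < e -> c <= \prod_i (z i + e)) -> c <= \prod_i z i.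
Proof.
move=> H; pose p := \prod_i ('X + (z i)%:P).
have pE e : p.[e] = \prod_i (z i + e).
  by rewrite horner_prod; apply: eq_bigr => i _; rewrite !hornerE addrC.
have -> : \prod_i z i = p.[0] by rewrite pE; apply: eq_bigr => i _; rewrite addr0.
have pc : (p.[e] @[e --> 0^'+]) --> p.[0].
  apply: cvg_at_right_filter; exact: continuous_horner.
rewrite -(cvg_lim _ pc)//; apply: limr_ge; first by apply/cvg_ex; exists p.[0].
by near=> e; rewrite pE H.
Unshelve. all: by end_near. Qed.

(** The three constraints are moved into the objective one after the other, each time with the same
    Slater point. Testing the resulting Lagrangian bound on well-chosen masses yields the two
    conclusions on [psi]. *)
Lemma point_masses_dual (a b : R -> R) (v y0 : R) : 0 < a y0 -> 0 < b y0 ->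
  (forall x, point_masses x -> point_sum (cst 1) x <= 1 ->
    0 <= point_sum a x -> 0 <= point_sum b x -> log_mass x <= v) ->
  exists l0 l1 l2, [/\ 0 <= l1, 0 <= l2,
    forall y, l1 * a y + l2 * b y <= l0 &
    expR (l0 - n%:R - v) <= \prod_i (l0 - (l1 * a (xs i) + l2 * b (xs i)))].
Proof.
move=> ay0 by0 Hv; pose G0 x := 1 - point_sum (cst 1) x.
have [x0 [x0D x01 x0a x0b]] := point_masses_slater a b y0 ay0 by0.
have G0x0 : 0 < G0 x0 by rewrite subr_gt0.
have [l2 l2_ge0 H2] : exists2 l, 0 <= l & forall x,
    [/\ point_masses x, 0 <= G0 x & 0 <= point_sum a x] ->
    log_mass x + l * point_sum b x <= v.
  apply: (@lagrange_multiplier _ _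
    [set x | [/\ point_masses x, 0 <= G0 x & 0 <= point_sum a x]] log_mass (point_sum b)).
  - move=> x y t [xD x0' xa] [yD y0' ya] t01; have /andP[t0 t1] := t01.
    have [z [zD zF zE]] := point_masses_conv x y t xD yD t01.
    exists z; split; rewrite /G0 ?zE//; split => //; rewrite ?zE.
      by move: x0' y0'; rewrite /G0; nra.
    by rewrite addr_ge0// mulr_ge0// subr_ge0.
  - by exists x0; split => //; split => //; exact: ltW.
  - by move=> x [xD x0' xa] xb; apply: Hv => //; rewrite -subr_ge0.
have [l1 l1_ge0 H1] : exists2 l, 0 <= l & forall x,
    (point_masses x /\ 0 <= G0 x) ->
    (log_mass x + l2 * point_sum b x) + l * point_sum a x <= v.
  apply: (@lagrange_multiplier _ _ [set x | point_masses x /\ 0 <= G0 x]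
    (fun x => log_mass x + l2 * point_sum b x) (point_sum a)).
  - move=> x y t [xD x0'] [yD y0'] t01; have /andP[t0 t1] := t01.
    have [z [zD zF zE]] := point_masses_conv x y t xD yD t01.
    exists z; split; rewrite /G0 ?zE//; last by lra.
    by split => //; move: x0' y0'; rewrite /G0 zE; nra.
  - by exists x0; split => //; split => //; exact: ltW.
  - by move=> x [xD x0'] xa; exact: H2.
have [l0 l0_ge0 H0] : exists2 l, 0 <= l & forall x, point_masses x ->
    (log_mass x + l2 * point_sum b x + l1 * point_sum a x) + l * G0 x <= v.
  apply: (@lagrange_multiplier _ _ point_masses
    (fun x => log_mass x + l2 * point_sum b x + l1 * point_sum a x) G0).
  - move=> x y t xD yD t01; have [z [zD zF zE]] := point_masses_conv x y t xD yD t01.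
    by exists z; split => //; rewrite /G0 !zE; lra.
  - by exists x0; split => //; exact: ltW.
  - by move=> x xD x0'; exact: H1.
exists l0, l1, l2; pose psi y := l0 - (l1 * a y + l2 * b y).
have {}H0 x : point_masses x -> log_mass x + l0 - point_sum psi x <= v.
  move=> /H0; rewrite /G0.
  have -> : point_sum psi x = l0 * point_sum (cst 1) x - l1 * point_sum a x - l2 * point_sum b x.
    rewrite /point_sum !mulrDr !mulr_sumr !opprD !addrA.
    rewrite [RHS](ACl ((1*3*5)*(2*4*6)))/= -!sumrN -!big_split/=.
    by congr (_ + _); apply: eq_bigr => i _; rewrite /psi; ring.
  by lra.
have psi0 y : 0 <= psi y.
  rewrite leNgt; apply/negP => psiy.
  (* Unit masses at the samples and a large mass where [psi] is negative would give
     [1 + |K| <= K]. *)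
  pose K := v - l0 + \sum_i psi (xs i).
  have q0 : 0 <= (1 + `|K|) / - psi y by rewrite divr_ge0// oppr_ge0 ltW.
  have := H0 (cst 1, [:: ((1 + `|K|) / - psi y, y)]).
  rewrite /point_masses/= q0 => /(_ (conj (fun=> ltr01) erefl)).
  rewrite /log_mass /point_sum/= big_seq1/=.
  under eq_bigr do rewrite ln1.
  rewrite big1//; under eq_bigr do rewrite mul1r.
  have -> : (1 + `|K|) / - psi y * psi y = - (1 + `|K|) by field; rewrite lt_eqF.
  by have := ler_norm K; rewrite /K; lra.
split => // [y|]; first by rewrite -subr_ge0; exact: psi0.
apply: le_prod_limit => e e0.
have pe i : 0 < psi (xs i) + e by rewrite ltr_wpDl.
(* Masses [1 / psi] at the samples maximize the Lagrangian; [e] guards against zeros of [psi] and is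
   removed by [le_prod_limit]. *)
have := H0 (fun y => (psi y + e)^-1, [::]).
rewrite /point_masses/= => /(_ _)/wrap[|].
  by split => // y; rewrite invr_gt0 ltr_wpDl.
rewrite /log_mass /point_sum/= big_nil addr0 => H.
have S1 : \sum_i (psi (xs i) + e)^-1 * psi (xs i) <= n%:R.
  rewrite -[X in X%:R](card_ord n) -sumr_const; apply: ler_sum => i _.
  by rewrite mulrC ler_pdivrMr// mul1r lerDl ltW.
have S2 : \sum_i ln (psi (xs i) + e)^-1 = - \sum_i ln (psi (xs i) + e).
  by rewrite -sumrN; apply: eq_bigr => i _; rewrite lnV// posrE.
have -> : \prod_i (l0 - (l1 * a (xs i) + l2 * b (xs i)) + e) =
    expR (\sum_i ln (psi (xs i) + e)).
  by rewrite expR_sum; apply: eq_bigr => i _; rewrite lnK// posrE.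
by rewrite ler_expR; move: H; rewrite S2; lra.
Qed.

End PointMassDuality.

Arguments point_sum {R n} xs phi x.
Arguments log_mass {R n} xs x.

(** * Finitely supported measures and the divergence of the empirical one *)

Section Atoms.
Context {R : realType}.
Local Open Scope ereal_scope.

(** The absolute value provides the nonnegative scalar required by [mscale] for an arbitrary
    list. *)
Definition atoms (L : seq (R * R)) : {measure set R -> \bar R} :=
  msum (fun k => mscale (`|(nth (0, 0) L k).1|%:nng)%R
    \d_((nth (0%R, 0%R) L k).2)) (size L).

Lemma atomsE (L : seq (R * R)) A : all (fun p => 0 <= p.1)%R L ->
  atoms L A = (\sum_(p <- L) p.1 * \1_A p.2)%:E.
Proof.
move=> /allP L0; rewrite (big_nth (0%R, 0%R)) big_mkord -sumEFin.
apply: eq_bigr => i _; rewrite /= /mscale/= EFinM ger0_norm//.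
by rewrite L0// mem_nth.
Qed.

Lemma integral_atoms (L : seq (R * R)) (phi : R -> R) :
  all (fun p => 0 <= p.1)%R L -> measurable_fun setT phi ->
  \int[atoms L]_x (phi x)%:E = (\sum_(p <- L) p.1 * phi p.2)%:E.
Proof.
move=> /allP L0.
have ge0_case (g : R -> R) : measurable_fun setT g -> (forall x, 0 <= g x)%R ->
    \int[atoms L]_x (g x)%:E = (\sum_(p <- L) p.1 * g p.2)%:E.
  move=> mg g0; have mEg : measurable_fun setT (EFin \o g) by exact/measurable_EFinP.
  rewrite ge0_integral_measure_sum//; last by move=> x _; rewrite lee_fin.
  rewrite (big_nth (0%R, 0%R)) big_mkord -sumEFin; apply: eq_bigr => i _.
  rewrite ge0_integral_mscale//; last by move=> x _; rewrite lee_fin.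
  rewrite integral_dirac// diracT mul1e EFinM/= ger0_norm//.
  by rewrite L0// mem_nth.
move=> mphi; rewrite integralE.
have -> : (fun x => (phi x)%:E) = EFin \o phi by [].
rewrite funerpos funerneg.
rewrite !ge0_case; [|exact: measurable_funrneg|exact: funrneg_ge0
                   |exact: measurable_funrpos|exact: funrpos_ge0].
rewrite -EFinB -sumrB; congr EFin; apply: eq_bigr => p _.
by rewrite -mulrBr -[in RHS](funrposBneg phi).
Qed.

Lemma probability_atoms (kappa : probability R R) (L : seq (R * R)) :
  all (fun p => 0 <= p.1)%R L -> (\sum_(p <- L) p.1 = 1)%R ->
  exists k : probability R R, forall A, k A = atoms L A.
Proof.
(* [kappa] is the default of [mnormalize] for total mass 0 or infinity; here the total mass is 1. *)
move=> L0 L1; exists (mnormalize (atoms L) kappa) => A.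
have LT : atoms L setT = 1.
  rewrite atomsE//; congr EFin; rewrite -L1; apply: eq_bigr => p _.
  by rewrite indicT mulr1.
rewrite -[LHS]/(mnormalize (atoms L) kappa A) /mnormalize LT onee_eq0 orFb.
by rewrite (_ : (1 == +oo) = false)// fine1 invr1 mule1.
Qed.

Lemma integral_empirical n (xs : nat -> R) (phi : R -> R) :
  measurable_fun setT phi ->
  \int[empirical n xs]_x (phi x)%:E = (n%:R^-1 * \sum_(i < n) phi (xs i))%:E.
Proof.
move=> mphi; pose L := [seq (n%:R^-1 : R, xs i)%R | i <- index_iota 0 n].
have L0 : all (fun p => 0 <= p.1)%R L.
  by apply/allP => p /mapP[i _ ->]/=; rewrite invr_ge0.
rewrite (eq_measure_integral (atoms L)); last first.
  move=> A mA _; rewrite atomsE// big_map/= big_mkord.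
  rewrite -mulr_sumr EFinM -sumEFin.
  by rewrite /empirical /= /mscale /msum.
rewrite integral_atoms// big_map/= big_mkord.
by rewrite mulr_sumr.
Qed.

(** An explicit density [g] bounds the infimum. A sample of multiplicity [c] has empirical mass
    [c / n] and [k]-mass at least [c * h], so ties cancel and [g] is at most [1 / (n * h)] there. *)
Lemma KL_empirical_le n (xs : nat -> R) (k : {measure set R -> \bar R}) (h : R -> R) :
  (0 < n)%N -> (forall y, 0 < h y)%R -> (forall A, k A \is a fin_num) ->
  (forall i : 'I_n, (\sum_(j < n) h (xs j) * (xs j == xs i)%:R)%:E <= k [set xs i]) ->
  KL (empirical n xs) k <=
    (- ln n%:R - n%:R^-1 * \sum_(i < n) ln (h (xs i)))%:E.
Proof.
move=> n0 h0 kfin kh; have n0' : (0 < n%:R :> R)%R by rewrite ltr0n.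
pose w i := fine (k [set xs i]).
have wE i : k [set xs i] = (w i)%:E by rewrite fineK.
pose c (i : nat) : R := (\sum_(j < n) (xs j == xs i)%:R)%R.
have c0 (i : 'I_n) : (0 < c i)%R.
  rewrite /c (bigD1 i)//= eqxx ltr_pwDl//; apply: sumr_ge0 => j _.
  by rewrite ler0n.
have chw (i : 'I_n) : (c i * h (xs i) <= w i)%R.
  have := kh i; rewrite wE lee_fin; apply: le_trans.
  rewrite mulr_suml; apply: ler_sum => j _.
  by case: eqP => [->|_]; rewrite ?mul1r ?mulr1// mul0r mulr0.
have w0 (i : 'I_n) : (0 < w i)%R.
  by apply: lt_le_trans (chw i); rewrite mulr_gt0.
(* The sum runs over indices, so a repeated sample receives its multiplicity automatically. *)
pose g x : R := (\sum_(i < n) (n%:R * w i)^-1 * \1_[set xs i] x)%R.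
have mg : measurable_fun setT g.
  by apply: measurable_sum => i; apply: measurable_funM => //; exact: measurable_indic.
have dg : is_density (empirical n xs) k g.
  split => //; split.
    move=> x; apply: sumr_ge0 => i _; rewrite mulr_ge0// invr_ge0 mulr_ge0 ?ltW//.
  move=> A mA.
  under eq_integral do rewrite /g -sumEFin.
  rewrite ge0_integral_sum//; last 2 first.
  - move=> i; apply/measurable_EFinP; apply: measurable_funTS.
    by apply: measurable_funM => //; exact: measurable_indic.
  - move=> i x _; rewrite lee_fin mulr_ge0// invr_ge0 mulr_ge0 ?ltW//.
  rewrite /empirical /= /mscale /msum ge0_sume_distrr; last by [].
  apply: eq_bigr => i _.
  under eq_integral do rewrite EFinM.
  rewrite ge0_integralZl//; last 2 first.
  - apply/measurable_EFinP; apply: measurable_funTS; exact: measurable_indic.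
  - by rewrite lee_fin invr_ge0 mulr_ge0 ?ltW.
  rewrite integral_indic//= diracE.
  have [/[!inE] xA|xA] := boolP (xs i \in A).
    rewrite (_ : _ `&` _ = [set xs i]); last first.
      by apply/seteqP; split => x /= => [[]|->].
    rewrite wE -!EFinM; congr EFin; rewrite mulr1 invfM -mulrA mulVf ?mulr1//.
    by rewrite gt_eqF.
  rewrite (_ : _ `&` _ = set0) ?measure0 ?mule0//.
  rewrite -subset0 => x [/= ->] Ax; by move: xA; rewrite notin_setE.
apply: le_trans (_ : \int[empirical n xs]_x (ln (g x))%:E <= _).
  by apply: ereal_inf_lbound; exists g.
rewrite integral_empirical; last exact: measurableT_comp (@measurable_ln R) mg.
rewrite lee_fin.
have -> : (- ln n%:R = n%:R^-1 * \sum_(i < n) - ln n%:R :> R)%R.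
  by rewrite sumr_const card_ord -[((- ln _) *+ n)%R]mulr_natl mulrA mulVf ?mul1r// gt_eqF.
rewrite -mulrBr -sumrB ler_wpM2l ?invr_ge0 ?ler0n//; apply: ler_sum => i _.
have gE : g (xs i) = (c i / (n%:R * w i))%R.
  rewrite /g /c mulr_suml; apply: eq_bigr => j _; rewrite indicE.
  have -> : (xs i \in [set xs j]) = (xs j == xs i).
    by apply/idP/eqP => [/set_mem ->//|->]; exact/mem_set.
  by case: eqP => [xx|_]; rewrite ?mulr0 ?mul0r// mulr1 mul1r /w xx.
have nw0 : (0 < n%:R * w i)%R by rewrite mulr_gt0.
have nh0 : (0 < n%:R * h (xs i))%R by rewrite mulr_gt0.
rewrite -opprD -lnM ?posrE// -lnV ?posrE// ler_ln ?posrE ?invr_gt0//; last first.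
  by rewrite gE divr_gt0.
rewrite gE ler_pdivrMr// mulrC ler_pdivlMr//.
by rewrite mulrCA ler_pM2l// chw.
Qed.

End Atoms.

(** * From a lower bound on [KLinf] to a dual multiplier *)

Section KLinfDual.
Context {R : realType}.
Variables (f : R -> R) (B : R).
Hypothesis mf : measurable_fun setT (fun y : R => f `|y|).
Let b (y : R) := B - f `|y|.

(** The missing mass is put at [m], where it contributes nothing to the mean constraint and a
    nonnegative amount to the moment constraint. *)
Lemma feasible_probability (kappa : probability R R) (n : nat) (xs : nat -> R)
    (m s : R) x : (0 < n)%N -> 0 <= b m ->
  let ys := fun i : 'I_n => xs i in
  point_masses x -> point_sum ys (cst 1) x <= 1 ->
  0 <= point_sum ys (fun y => s * (y - m)) x -> 0 <= point_sum ys b x ->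
  exists k : probability R R, [/\ inL f B k, 0 <= s * (mean k - m) &
    (KL (empirical n xs) k <= (- ln n%:R - n%:R^-1 * log_mass ys x)%:E)%E].
Proof.
move=> n0 bm ys [h0 /allP r0] x1 xa xb.
pose L := [seq (x.1 (xs i), xs i) | i <- index_iota 0 n] ++
  x.2 ++ [:: (1 - point_sum ys (cst 1) x, m)].
have LE (phi : R -> R) : \sum_(p <- L) p.1 * phi p.2 =
    point_sum ys phi x + (1 - point_sum ys (cst 1) x) * phi m.
  by rewrite !big_cat/= big_map big_mkord big_seq1 addrA.
have L0 : all (fun p => 0 <= p.1) L.
  rewrite !all_cat/= andbT subr_ge0 x1 andbT; apply/andP; split; apply/allP => p.
    by move=> /mapP[i _ ->]/=; exact: ltW.
  exact: r0.
have L1 : \sum_(p <- L) p.1 = 1.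
  have := LE (cst 1); rewrite /= mulr1 addrC subrK => <-.
  by apply: eq_bigr => p _; rewrite mulr1.
have [k kE] := probability_atoms kappa L L0 L1.
have kI (phi : R -> R) : measurable_fun setT phi ->
    (\int[k]_x (phi x)%:E = (\sum_(p <- L) p.1 * phi p.2)%:E)%E.
  move=> mphi; rewrite -integral_atoms//; apply: eq_measure_integral => A mA _.
  exact: kE.
exists k; split.
- split.
    apply/integrableP; split; first exact/measurable_EFinP.
    under eq_integral do rewrite /=.
    by rewrite kI ?ltry//; exact: measurableT_comp.
  rewrite kI// lee_fin -subr_ge0 -[B]mulr1 -L1 mulr_sumr -sumrB.
  have -> : \sum_(p <- L) (B * p.1 - p.1 * f `|p.2|) = \sum_(p <- L) p.1 * b p.2.
    by apply: eq_bigr => p _; rewrite /b; ring.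
  by rewrite LE addr_ge0// mulr_ge0// subr_ge0.
- rewrite /mean kI//= -[m]mulr1 -L1 mulr_sumr -sumrB mulr_sumr.
  have -> : \sum_(p <- L) s * (p.1 * p.2 - m * p.1) = \sum_(p <- L) p.1 * (s * (p.2 - m)).
    by apply: eq_bigr => p _; ring.
  by rewrite (LE (fun y => s * (y - m))) subrr !mulr0 addr0.
- apply: KL_empirical_le => // [A|i]; first by rewrite [X in X \is a _](kE A) atomsE.
  rewrite [X in (_ <= X)%E](kE [set xs i]) atomsE// lee_fin (LE (\1_[set xs i])) /point_sum -addrA.
  apply: (@le_trans _ _ (\sum_(j < n) x.1 (ys j) * \1_[set xs i] (ys j))).
    apply: ler_sum => j _; rewrite indicE.
    suff -> : (ys j \in [set xs i]) = (xs j == xs i) by [].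
    by apply/idP/eqP => [/set_mem//|E]; exact/mem_set.
  rewrite lerDl addr_ge0//; last by rewrite mulr_ge0 ?subr_ge0.
  by rewrite big_seq; apply: sumr_ge0 => p px; rewrite mulr_ge0 ?r0.
Qed.

Lemma concave_fun_near (m s : R) : concave_fun b -> 0 < b m -> s = 1 \/ s = -1 ->
  exists y, 0 < s * (y - m) /\ 0 < b y.
Proof.
move=> cb bm s1; pose c := b m + `|b (m + s)|.
have c0 : 0 < c by rewrite ltr_pwDl.
(* By concavity a step of length [t] towards [m + s] lowers [b] by at most [t * c = b m / 2]. *)
pose t := b m / (2 * c); have t0 : 0 < t by rewrite divr_gt0// mulr_gt0.
have tc : t * c = b m / 2 by rewrite /t; field; rewrite gt_eqF.
have bc : b m <= c by rewrite lerDl.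
have t1 : t <= 1 by rewrite ler_pdivrMr ?mulr_gt0//; lra.
exists (m + s * t); split.
  by rewrite addrC addKr; case: s1 => ->; lra.
have := cb (m + s) m t; rewrite (ltW t0) t1 => /(_ isT).
have -> : t * (m + s) + (1 - t) * m = m + s * t by ring.
apply: lt_le_trans.
have : - `|b (m + s)| <= b (m + s) by rewrite lerNl -normrN ler_norm.
move: tc; rewrite /c; nra.
Qed.

(** Feasible point masses have [log_mass] at most [n * (- ln n - u)]; the resulting multipliers are
    divided by [l0] to land in the region. *)
Lemma KLinf_dual (kappa : probability R R) (n : nat) (xs : nat -> R) (m u : R) :
  (0 < n)%N -> concave_fun b -> 0 < b m ->
  (u%:E <= KLinf f B (empirical n xs) m)%E ->
  exists2 l, dual_region b m l &
    expR (n%:R * u) <= \prod_(i < n) dual_factor b m l (xs i).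
Proof.
move=> n0 cb bm uKL; have n0' : 0 < n%:R :> R by rewrite ltr0n.
pose ys := fun i : 'I_n => xs i.
(* The sign [s] records on which side of [m] the mean is constrained, so one linear constraint
   serves both cases of [KLinf]. *)
have [s s1 sKL] : exists2 s : R, s = 1 \/ s = -1 & forall k : probability R R,
    inL f B k -> 0 <= s * (mean k - m) -> (u%:E <= KL (empirical n xs) k)%E.
  move: uKL; rewrite /KLinf; case: ifPn => _ uKL; [exists 1; first by left|exists (-1); first by right].
  - move=> k kL; rewrite mul1r subr_ge0 => km; apply: (le_trans uKL).
    by apply: ereal_inf_lbound; exists k.
  - move=> k kL; rewrite mulN1r oppr_ge0 subr_le0 => km; apply: (le_trans uKL).
    by apply: ereal_inf_lbound; exists k.
have [y0 [ay0 by0]] := concave_fun_near m s cb bm s1.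
have [|l0 [l1 [l2 [l1_ge0 l2_ge0 lle lprod]]]] := @point_masses_dual _ n ys
    (fun y => s * (y - m)) b (n%:R * (- ln n%:R - u)) y0 ay0 by0.
  move=> x xD x1 xa xb.
  have [k [kL km kKL]] := feasible_probability kappa n xs m s x n0 (ltW bm) xD x1 xa xb.
  have := le_trans (sKL k kL km) kKL; rewrite lee_fin.
  move=> le_u; have : n%:R^-1 * log_mass ys x <= - ln n%:R - u by lra.
  by rewrite -(ler_pM2l n0') mulrA divff ?mul1r// gt_eqF.
(* If [l0] were 0, evaluating at [m] and [y0] would make all multipliers 0, and the product,
   nonempty since [0 < n], would vanish. *)
have l0_gt0 : 0 < l0.
  have := lle m; rewrite subrr !mulr0 add0r => l2b.
  rewrite lt_neqAle (le_trans _ l2b) ?mulr_ge0 ?(ltW bm)// andbT.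
  apply/eqP => l00; move: lprod; rewrite leNgt => /negP; apply.
  have l20 : l2 = 0 by apply/eqP; rewrite eq_le l2_ge0 andbT -(pmulr_lle0 _ bm) l00.
  have l10 : l1 = 0.
    apply/eqP; rewrite eq_le l1_ge0 andbT -(pmulr_lle0 _ ay0).
    by have := lle y0; rewrite l20 mul0r addr0 -l00.
  rewrite (bigD1 (Ordinal n0))//= l10 l20 -l00 !mul0r addr0 subrr mul0r.
  exact: expR_gt0.
exists (s * l1 / l0, l2 / l0).
  split => [|y] /=; first by rewrite divr_ge0// ltW.
  have -> : dual_factor b m (s * l1 / l0, l2 / l0) y =
      (l0 - (l1 * (s * (y - m)) + l2 * b y)) / l0.
    by rewrite /dual_factor/=; field; rewrite gt_eqF.
  by rewrite divr_ge0 ?subr_ge0 ?lle// ltW.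
have -> : \prod_(i < n) dual_factor b m (s * l1 / l0, l2 / l0) (xs i) =
    (\prod_i (l0 - (l1 * (s * (ys i - m)) + l2 * b (ys i)))) / l0 ^+ n.
  rewrite -[X in l0 ^+ X](card_ord n) -prodr_const -prodf_div.
  by apply: eq_bigr => i _; rewrite /dual_factor/= /ys; field; rewrite gt_eqF.
rewrite ler_pdivlMr ?exprn_gt0//; apply: le_trans lprod.
have -> : l0 ^+ n = expR (n%:R * ln l0) by rewrite expRM_natl lnK// posrE.
rewrite -expRD ler_expR.
(* Dividing by [l0 ^ n] leaves the exponent [n * u] plus [l0 - n - n * ln (l0 / n)], which is
   nonnegative by this inequality. *)
have : ln (1 + (l0 / n%:R - 1)) <= l0 / n%:R - 1.
  by rewrite le_ln1Dx// ltrBrDr addNr divr_gt0.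
rewrite addrC subrK ln_div ?posrE// -(ler_pM2l n0') !mulrBr mulr1 [_ * (l0 / _)]mulrCA divff ?gt_eqF//.
by rewrite mulr1; lra.
Qed.

End KLinfDual.

(** * Expectation of a dual factor, and regularity of [B - f |y|] *)

Section Integrability.
Context {R : realType}.

Lemma measurable_dual_factor (b : R -> R) (m : R) (l : R * R) :
  measurable_fun setT b -> measurable_fun setT (dual_factor b m l).
Proof.
move=> mb; apply: measurable_funB; last exact: measurable_funM.
by apply: measurable_funB => //; apply: measurable_funM => //; exact: measurable_funB.
Qed.

(** The linear term integrates to 0 and the moment term, with [0 <= l.2], can only lower the value
    1. *)
Lemma integral_dual_factor (f : R -> R) (B : R) (kappa : probability R R) (l : R * R) :
  measurable_fun setT (fun y : R => f `|y|) -> (forall y : R, 0 <= f `|y|) ->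
  inL f B kappa ->
  dual_region (fun y : R => B - f `|y|) (mean kappa) l ->
  exists2 e : R, 0 <= e <= 1 &
    (\int[kappa]_x (dual_factor (fun y : R => B - f `|y|) (mean kappa) l x)%:E = e%:E)%E.
Proof.
move=> mf f0 [ikappa fB] [l2 lp]; set m := mean kappa.
have mEf : measurable_fun setT (fun y : R => (f `|y|)%:E) by exact/measurable_EFinP.
have fI0 : (0 <= \int[kappa]_x (f `|x|)%:E)%E.
  by apply: integral_ge0 => x _; rewrite lee_fin.
have ffin : (\int[kappa]_x (f `|x|)%:E)%E \is a fin_num.
  by rewrite ge0_fin_numE// (le_lt_trans fB)// ltry.
have intf : kappa.-integrable setT (fun y : R => (f `|y|)%:E).
  apply/integrableP; split => //.
  under eq_integral do rewrite gee0_abs ?lee_fin//.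
  by rewrite (le_lt_trans fB)// ltry.
have xfin : (\int[kappa]_x x%:E)%E \is a fin_num by exact: integrable_fin_num.
pose Ef := fine (\int[kappa]_x (f `|x|)%:E)%E.
have EfE : (\int[kappa]_x (f `|x|)%:E = Ef%:E)%E by rewrite fineK.
have mE : (\int[kappa]_x x%:E = m%:E)%E by rewrite /m /mean fineK.
have EfB : Ef <= B by rewrite -lee_fin -EfE.
have I : (\int[kappa]_x (dual_factor (fun y : R => B - f `|y|) m l x)%:E =
    (1 - l.2 * (B - Ef))%:E)%E.
  under eq_integral => x _.
    have -> : dual_factor (fun y : R => B - f `|y|) m l x =
        (1 + l.1 * m - l.2 * B) + (- l.1 * x + l.2 * f `|x|).
      by rewrite /dual_factor; ring.
    rewrite EFinD [X in (_ + X)%E]EFinD (EFinM _ x) (EFinM _ (f _)).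
    over.
  have i1 : kappa.-integrable setT (fun x : R => (- l.1)%:E * x%:E)%E.
    exact: integrableZl.
  have i2 : kappa.-integrable setT (fun x : R => l.2%:E * (f `|x|)%:E)%E.
    exact: integrableZl.
  have i0 : kappa.-integrable setT (fun x : R => (1 + l.1 * m - l.2 * B)%:E).
    exact: finite_measure_integrable_cst.
  rewrite integralD//; last exact: integrableD.
  rewrite integralD// !integralZl// integral_cst//.
  rewrite [X in (_ * X)%E](@probability_setT _ _ _ kappa) mule1.
  by rewrite EfE mE -!EFinM -!EFinD; congr EFin; ring.
exists (1 - l.2 * (B - Ef)) => //; rewrite -lee_fin -I integral_ge0/=.
  by rewrite gerBl mulr_ge0 ?subr_ge0.
by move=> x _; rewrite lee_fin.
Qed.

Lemma le_of_le_div_nat (p a c : R) : 0 <= c ->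
  (forall k : nat, p <= a + c / k.+1%:R) -> p <= a.
Proof.
move=> c0 H; apply/ler_addgt0Pr => e e0.
have [k ck] : exists k : nat, c / e <= k.+1%:R.
  exists (Num.truncn (c / e)); apply/ltW.
  by have /andP[_] := truncn_itv (divr_ge0 c0 (ltW e0)).
apply: (le_trans (H k)); rewrite lerD2l ler_pdivrMr ?ltr0n//.
by rewrite mulrC -ler_pdivrMr.
Qed.

(** An increasing convex function composed with the convex absolute value is convex. *)
Lemma concave_fun_comp_norm (f : R -> R) (B : R) :
  {in [set y : R | 0 <= y] &, forall x y, x < y -> f x < f y} ->
  convex_on_nonneg f -> concave_fun (fun y : R => B - f `|y|).
Proof.
move=> fi fc x y t /andP[t0 t1].
have fm (z w : R) : 0 <= z -> z <= w -> f z <= f w.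
  move=> z0; rewrite le_eqVlt => /orP[/eqP->//|zw]; apply/ltW/fi => //; rewrite inE//=.
  exact: le_trans (ltW zw).
have t1' : 0 <= 1 - t by rewrite subr_ge0.
have c : f (t * `|x| + (1 - t) * `|y|) <= t * f `|x| + (1 - t) * f `|y|.
  by apply: fc => //; rewrite t0.
have d : f `|t * x + (1 - t) * y| <= f (t * `|x| + (1 - t) * `|y|).
  apply: fm => //; rewrite (le_trans (ler_normD _ _))// !normrM.
  by rewrite (ger0_norm t0) (ger0_norm t1').
lra.
Qed.

Lemma measurable_comp_norm (f : R -> R) :
  {within [set y : R | 0 <= y], continuous f} ->
  measurable_fun setT (fun y : R => f `|y|).
Proof.
have E : [set y : R | 0 <= y] = `[0, +oo[%classic.
  by apply/seteqP; split => y /=; rewrite in_itv/= andbT.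
rewrite E => fc.
suff : measurable_fun setT (f \o (fun y : R => `|y|)) by [].
apply: (@measurable_comp _ _ _ R R R `[0, +oo[%classic) => //.
- by move=> _ [y _ <-]/=; rewrite in_itv/= normr_ge0.
- exact: subspace_continuous_measurable_fun.
Qed.

End Integrability.

(** * The deviation bound, by Markov's inequality on ever finer grids *)

Theorem theorem11 (R : realType) (f : R -> R) (B : R)
  (f_nonneg : forall y, 0 <= y -> 0 <= f y)
  (f_incr : {in [set y : R | 0 <= y] &, forall x y, x < y -> f x < f y})
  (f_cont : {within [set y : R | 0 <= y], continuous f})
  (f_convex : convex_on_nonneg f)
  (f_superlin : (f y / y) @[y --> +oo] --> +oo)
  (B_gt0 : 0 < B)
  (finvB : R) (finvB_ge0 : 0 <= finvB) (finvB_def : f finvB = B)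
  (kappa : probability R R) (kappa_L : inL f B kappa)
  (mkappa : f `|mean kappa| < B)
  (d : measure_display) (T : measurableType d) (P : probability T R)
  (n : nat) (n_gt0 : (0 < n)%N) (X : nat -> {RV P >-> R})
  (X_indep : mutually_independent n X)
  (X_law : forall i A, (i < n)%N -> measurable A -> P (X i @^-1` A) = kappa A)
  (u : R) (u_ge0 : 0 <= u) :
  let m := mean kappa in
  let d1 := fine (\int[kappa]_x (`|x - m|)%:E)%E / (2 * (finvB - m)) in
  let d2 := fine (\int[kappa]_x (`|B - f `|x| |)%:E)%E / (2 * (B - f `|m|)) in
  let B1 := d1 + d2 in
  exists2 E : set T, measurable E /\
      [set w | (u%:E <= KLinf f B (empirical n (fun i => X i w)) m)%E] `<=` E &
    (P E <= ((n.+1%:R) ^+ 2 * expR B1 * expR (- (n%:R * u)))%:E)%E.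
Proof.
move=> m d1 d2 B1.
have mf := measurable_comp_norm f f_cont.
have fpos (y : R) : 0 <= f `|y| by exact: f_nonneg.
pose b (y : R) := B - f `|y|.
have mb : measurable_fun setT b by exact: measurable_funB.
have cb : concave_fun b by exact: concave_fun_comp_norm.
have bm : 0 < b m by rewrite subr_gt0.
(* Monotonicity of [f] gives [m <= finvB], so both denominators are nonnegative. *)
have B1_ge0 : 0 <= B1.
  have mF : m <= finvB.
    rewrite leNgt; apply/negP => Fm; have := mkappa; rewrite -/m -finvB_def ltNge.
    have m0 : 0 < m by exact: le_lt_trans Fm.
    by rewrite gtr0_norm// ltW// f_incr// inE/= ?(ltW m0).
  rewrite addr_ge0// divr_ge0// ?fine_ge0//.
  - by apply: integral_ge0 => x _; rewrite lee_fin.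
  - by rewrite mulr_ge0// subr_ge0.
  - by apply: integral_ge0 => x _; rewrite lee_fin.
  - by rewrite mulr_ge0// subr_ge0 ltW.
have Eprod l : dual_region b m l ->
    (\int[P]_w (\prod_(i < n) dual_factor b m l (X i w))%:E <= 1)%E.
  move=> lD; have [e /andP[e0 e1] eE] := integral_dual_factor f B kappa l mf fpos kappa_L lD.
  have [_ lp] := lD.
  rewrite (independent_integral_prod _ _ _ P kappa n X X_indep X_law
    (fun=> dual_factor b m l) (fun=> e))//; last first.
    by move=> i; exact: measurable_dual_factor.
  by rewrite prodr_const card_ord lee_fin exprn_ile1.
(* This mesh makes [N / (n + 1) - 1] equal to [k + 1] exactly. *)
pose N k := (n.+1 * k.+2)%N.
have N0 k : (0 < N k)%N by rewrite muln_gt0.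
have nN k : (n < N k)%N by rewrite /N leq_pmulr.
have grid k := cid2 (dual_region_grid b m (N k) cb bm (N0 k)).
pose g k := s2val (grid k).
have gD k i j : (i <= N k)%N -> (j <= N k)%N -> dual_region b m (g k i j).
  exact: (s2valP (grid k)).
have gP k := s2valP' (grid k).
pose W k w := \sum_(i < (N k).+1) \sum_(j < (N k).+1)
  \prod_(q < n) dual_factor b m (g k i j) (X q w).
have Z0 k (i j : 'I_(N k).+1) w : 0 <= \prod_(q < n) dual_factor b m (g k i j) (X q w).
  by apply: prodr_ge0 => q _; have [] := gD k i j (leq_ord i) (leq_ord j).
have mZ k (i j : 'I_(N k).+1) : measurable_fun setT
    (fun w => \prod_(q < n) dual_factor b m (g k i j) (X q w)).
  apply: measurable_prod => q _; apply: measurableT_comp => //.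
  exact: measurable_dual_factor.
have mW k : measurable_fun setT (W k).
  by apply: measurable_sum => i; exact: measurable_sum.
have W0 k w : 0 <= W k w by do 2 (apply: sumr_ge0 => ? _).
have EW k : (\int[P]_w (W k w)%:E <= ((N k).+1%:R ^+ 2)%:E)%E.
  have -> : (\int[P]_w (W k w)%:E = \sum_(i < (N k).+1) \sum_(j < (N k).+1)
      \int[P]_w (\prod_(q < n) dual_factor b m (g k i j) (X q w))%:E)%E.
    under eq_integral do rewrite /W -sumEFin.
    rewrite ge0_integral_sum//; last 2 first.
    - by move=> i; apply/measurable_EFinP; exact: measurable_sum.
    - by move=> i w _; rewrite lee_fin sumr_ge0.
    apply: eq_bigr => i _.
    under eq_integral do rewrite -sumEFin.
    rewrite ge0_integral_sum//.
    - by move=> j; apply/measurable_EFinP.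
    - by move=> j w _; rewrite lee_fin.
  apply: (@le_trans _ _ (\sum_(i < (N k).+1) \sum_(j < (N k).+1) 1%:E)%E).
    by apply: lee_sum => i _; apply: lee_sum => j _; apply: Eprod; apply: gD; rewrite -ltnS.
  under eq_bigr do rewrite sumEFin sumr_const card_ord.
  by rewrite sumEFin sumr_const card_ord lee_fin -mulrnA natrM.
(* The level that the grid sum [W k] reaches whenever the event occurs. *)
pose c k : R := k.+1%:R ^+ 2 * expR (n%:R * u).
have c0 k : 0 < c k by rewrite mulr_gt0 ?exprn_gt0 ?expR_gt0.
pose E_ k := [set w | c k <= W k w].
have mE_ k : measurable (E_ k).
  rewrite -[E_ k]setTI; rewrite (_ : _ `&` _ = setT `&` (W k @^-1` `[c k, +oo[)).
    by apply: mW.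
  by congr (_ `&` _); apply/seteqP; split => w /=; rewrite in_itv/= andbT.
have PE_ k : (P (E_ k) <= ((N k).+1%:R ^+ 2 / c k)%:E)%E.
  have mEW : measurable_fun setT (EFin \o W k) by exact/measurable_EFinP.
  have := @le_integral_abse _ _ _ P setT measurableT _ (c k) mEW (c0 k).
  rewrite setTI.
  have -> : [set w | ((c k)%:E <= `|(EFin \o W k) w|)%E] = E_ k.
    by apply/seteqP; split => w /=; rewrite lee_fin ger0_norm.
  under eq_integral do rewrite /= ger0_norm//.
  move=> /le_trans/(_ (EW k)).
  by rewrite -lee_pdivlMl// -EFinM mulrC.
(* Each [E_ k] is measurable and contains the event; the intersection inherits the Markov bounds of
   all [k] at once. *)
exists (\bigcap_k E_ k).
  split; first exact: bigcap_measurable.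
  move=> w /= uw k _ /=.
  have [l lD lu] := KLinf_dual f B mf kappa n (fun i => X i w) m u n_gt0 cb bm uw.
  have := gP k n (fun i => X i w) l n_gt0 (nN k) lD; apply: le_trans.
  have -> : (N k)%:R / n.+1%:R - 1 = k.+1%:R :> R.
    rewrite /N natrM mulrC mulrA mulVf ?mul1r// ?pnatr_eq0//.
    by rewrite -[k.+2]addn1 natrD addrK.
  by rewrite /c ler_wpM2l// exprn_ge0.
set E := \bigcap_k E_ k.
have mE : measurable E by exact: bigcap_measurable.
have PfE : P E = (fine (P E))%:E by rewrite fineK// fin_num_measure.
have PE k : fine (P E) <= (N k).+1%:R ^+ 2 / c k.
  rewrite -lee_fin -PfE; apply: le_trans (PE_ k).
  by apply: le_measure; rewrite ?inE//; apply: bigcap_inf.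
rewrite PfE lee_fin.
pose a : R := n.+1%:R ^+ 2; pose e := expR (- (n%:R * u)).
have e0 : 0 < e by exact: expR_gt0.
apply: (@le_trans _ _ (a * e)); last first.
  by rewrite ler_pM2r// ler_peMr ?exprn_ge0// -expR0 ler_expR.
(* [(N + 1) / (k + 1)] equals [(n + 1) + (n + 2) / (k + 1)]; since [1 / (k + 1) <= 1], its square
   exceeds [(n + 1) ^ 2] by at most [C / (k + 1)]. *)
pose C : R := 2 * n.+1%:R * n.+2%:R + n.+2%:R ^+ 2.
have C0 : 0 <= C by rewrite addr_ge0// ?mulr_ge0// exprn_ge0.
apply: (@le_of_le_div_nat _ _ _ (C * e)); first by rewrite mulr_ge0// ltW.
move=> k; apply: (le_trans (PE k)).
have -> : (N k).+1%:R ^+ 2 / c k = ((N k).+1%:R / k.+1%:R) ^+ 2 * e.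
  by rewrite /c /e expRN invfM expr_div_n mulrA.
rewrite -[C * e / _]mulrAC -mulrDl ler_pM2r//.
have -> : (N k).+1%:R / k.+1%:R = n.+1%:R + n.+2%:R / k.+1%:R :> R.
  have -> : (N k).+1%:R = n.+1%:R * k.+1%:R + n.+2%:R :> R.
    by rewrite -natrM -natrD /N; congr (_%:R); lia.
  by rewrite mulrDl mulfK// pnatr_eq0.
have k1 : k.+1%:R^-1 <= 1 :> R by rewrite invf_le1// ler1n.
have k0 : 0 <= k.+1%:R^-1 :> R by rewrite invr_ge0.
rewrite /a /C; move: k0 k1; move: (k.+1%:R^-1) => r r0 r1.
have n2 : 0 <= n.+2%:R ^+ 2 :> R by rewrite exprn_ge0.
move: n2; move: (n.+1%:R : R) (n.+2%:R : R) => p q q2; rewrite -subr_ge0.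
have -> : p ^+ 2 + (2 * p * q + q ^+ 2) * r - (p + q * r) ^+ 2 =
    q ^+ 2 * (r * (1 - r)) by ring.
by rewrite mulr_ge0// mulr_ge0// subr_ge0.
Qed.
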